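(* Let $h\ge 1$, let $n_1<\ldots<n_h$ be positive integers, let $s_1,\ldots,s_h$ be positive integers, and let $a_{\ell,i}$ ($1\le \ell\le h$, $1\le i\le s_\ell$) be integers. Consider the Diophantine equation $$\sum_{\ell=1}^h\left(\sum_{i=1}^{s_\ell}a_{\ell,i}\,x_{\ell,i}^{n_\ell}\right)=0$$ in the unknowns $x_{\ell,i}$ ($1\le \ell\le h$, $1\le i\le s_\ell$). Suppose there exists a prime $p$ such that: (1) $\sum_{i\in\Gamma_\ell}a_{\ell,i}\not\equiv 0 \pmod p$ for every $\ell\in[h]$ and for every nonempty $\Gamma_\ell\subseteq[s_\ell]$; (2) $\sum_{\ell=1}^h\left(\sum_{i=1}^{s_\ell}a_{\ell,i}\right)\rho^{n_\ell}\not\equiv 0\pmod p$ for every integer $\rho\not\equiv 0\pmod p$. Then the equation is not partition regular on $\mathbb{N}$, except possibly for constant solutions.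
   Context: $\mathbb{N}$ denotes the set of positive integers and $[n]=\{1,\ldots,n\}$. An equation $f(x_1,\ldots,x_n)=0$ is partition regular on $\mathbb{N}$ if for every finite coloring (partition) $\mathbb{N}=C_1\cup\ldots\cup C_r$ there exist an index $i$ and elements $a_1,\ldots,a_n\in C_i$ (not necessarily distinct) with $f(a_1,\ldots,a_n)=0$; such a solution is called monochromatic. A solution is constant if all unknowns take the same value. ''Not partition regular on $\mathbb{N}$, except possibly for constant solutions'' means: there is a finite coloring of $\mathbb{N}$ for which every monochromatic solution of the equation (if there is any) is constant. *)

(* Defs.v *)
From mathcomp Require Import all_boot all_order all_algebra.

Set Implicit Arguments.
Unset Strict Implicit.
Unset Printing Implicit Defensive.

(* The positive integers are the [m : nat] with [0 < m]; an [r]-coloring of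
   them is the restriction of some [c : nat -> 'I_r], whose value at 0 is never
   used. The unknowns of an equation are indexed by a type [I]. *)

Definition positive_assignment (I : Type) (x : I -> nat) : Prop :=
  forall i, 0 < x i.

Definition monochromatic (r : nat) (c : nat -> 'I_r)
    (I : Type) (x : I -> nat) : Prop :=
  exists k : 'I_r, forall i, c (x i) = k.

Definition constant_assignment (I : Type) (x : I -> nat) : Prop :=
  exists m : nat, forall i, x i = m.

Definition not_partition_regular_except_constant
    (I : Type) (f : (I -> nat) -> int) : Prop :=
  exists (r : nat) (c : nat -> 'I_r),
    forall x : I -> nat, positive_assignment x -> f x = 0%R ->
      monochromatic c x -> constant_assignment x.

(* Main.v *)
Require Import Defs.
From mathcomp Require Import all_boot all_order all_algebra.
Import GRing.Theory.
Local Open Scope ring_scope.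

(** Write each unknown as x = p ^ e * u with u prime to p.  Dividing a solution
    by the least power of p occurring among its terms and reducing modulo p
    leaves only the terms for which n_l * e is least, each contributing
    a_{l,i} * u ^ n_l ([leading_part_eq0]).  The coloring [padic_color] makes
    this leading part impossible to cancel on a monochromatic tuple.  It records
    - the class of u modulo p, so that all the u share one class rho;
    - whether e = 0.  If so for all unknowns, every term is leading and the
      leading part is the sum over l of (sum_i a_{l,i}) * rho ^ n_l, nonzero by
      the assumption on full sums;
    - the exponents of the prime factorization of e modulo N + 1, where N is the
      largest of the n_l.  If all the e are positive, two leading terms, in
      blocks l and m with p-adic exponents e and f, satisfy n_l * e = n_m * f,
      and this information forces n_l = n_m ([eq_of_mul_eq_logn_mod]), hence
      l = m.  The leading part is then rho ^ n_l times a nonempty subsum of the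
      coefficients of one block, nonzero by the assumption on subsums.

    So this coloring has no monochromatic solution at all, constant or not. *)

(** If m * e = n * f, then at every prime r the exponents of e and f differ by
    the difference of those of n and m, which is smaller than N + 1 in absolute
    value; a congruence modulo N + 1 therefore forces it to vanish.  Primes
    r > N divide neither m nor n. *)
Lemma eq_of_mul_eq_logn_mod (N m n e f : nat) :
  (0 < m <= N)%N -> (0 < n <= N)%N -> (0 < e)%N -> (0 < f)%N ->
  (m * e = n * f)%N ->
  (forall r, (r <= N)%N -> logn r e = logn r f %[mod N.+1]) -> m = n.
Proof.
move=> /andP[m0 mN] /andP[n0 nN] e0 f0 mef ef.
apply: eqn_from_log => // r.
have [rN|Nr] := leqP r N; last first.
  by rewrite !ltn_log0 // (leq_ltn_trans _ Nr).
have := congr1 (logn r) mef; rewrite !lognM // => lmef.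
have : logn r m = logn r n %[mod N.+1].
  apply/eqP; rewrite -(eqn_modDr (logn r e)) lmef -modnDmr -(ef r rN).
  by rewrite modnDmr.
have small k : (0 < k <= N)%N -> (logn r k < N.+1)%N.
  by move=> /andP[k0 kN]; rewrite ltnS ltnW // (leq_trans (ltn_logl r k0)).
by rewrite !modn_small ?small ?m0 ?n0.
Qed.

Definition unit_residue (p x : nat) : 'F_p := (x`_p^')%N%:R.

Lemma unit_residue_neq0 (p x : nat) : prime p -> unit_residue p x != 0.
Proof.
move=> p_pr; rewrite /unit_residue -(dvdn_pcharf (pchar_Fp p_pr)).
by rewrite -p'natE // part_pnat.
Qed.

(** The reduction modulo p of the equation divided by p ^ M: the terms whose
    p-adic valuation exceeds M die, the others keep their prime-to-p part. *)
Lemma leading_part_eq0 (p : nat) (J : finType) (a : J -> int) (x k : J -> nat)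
    (M : nat) :
  prime p -> (forall j, (0 < x j)%N) ->
  (forall j, M <= k j * logn p (x j))%N ->
  \sum_j a j * (x j)%:Z ^+ k j = 0 ->
  \sum_(j | (k j * logn p (x j) == M)%N)
     (a j)%:~R * unit_residue p (x j) ^+ k j = 0 :> 'F_p.
Proof.
move=> p_pr x0 Mle.
have -> : \sum_j a j * (x j)%:Z ^+ k j = (p ^ M)%N%:Z *
    \sum_j a j * (p ^ (k j * logn p (x j) - M) * (x j)`_p^' ^ k j)%N%:Z.
  (* Termwise, a * x ^ k = p ^ M * (a * p ^ (k * e - M) * u ^ k), the truncated
     subtraction being exact since M <= k * e. *)
  rewrite mulr_sumr; apply: eq_bigr => j _.
  rewrite mulrCA -PoszM; congr (_ * _).
  rewrite mulnA -expnD subnKC // mulnC expnM expnAC -expnMn mulnC.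
  by rewrite -p_part partnC // -!natz natrX.
move/eqP; rewrite mulf_eq0 => /orP[|/eqP/(congr1 (fun z => z%:~R : 'F_p))].
  by rewrite eqz_nat expn_eq0 -[p == 0]negbK -lt0n prime_gt0.
rewrite rmorph_sum rmorph0 /=; apply: etrans.
rewrite big_mkcond /=; apply: eq_bigr => j _.
rewrite rmorphM /= -pmulrn natrM !natrX (pchar_Fp_0 p_pr) expr0n subn_eq0.
have [->|ne] := eqVneq; first by rewrite leqnn mul1r.
by rewrite leqNgt ltn_neqAle eq_sym ne Mle /= mul0r mulr0.
Qed.

Lemma not_partition_regular_of_finType (I : Type)
    (f : (I -> nat) -> int) (C : finType) (c : nat -> C) :
  (forall x, positive_assignment x -> (forall i j, c (x i) = c (x j)) ->
     f x <> 0) ->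
  not_partition_regular_except_constant f.
Proof.
move=> nosol; exists #|C|, (fun m => enum_rank (c m)) => x xpos fx0 [k ck].
case: (nosol x xpos _ fx0) => i j.
by apply: enum_rank_inj; rewrite !ck.
Qed.

(** The last component is what separates exponents e and f with e / f = m / n
    for distinct m, n <= N, using finitely many colors. *)
Definition padic_color (p N x : nat)
    : 'F_p * bool * {ffun 'I_N.+1 -> 'I_N.+1} :=
  (unit_residue p x, logn p x == 0%N,
   [ffun r : 'I_N.+1 => inord (logn r (logn p x) %% N.+1)]).

Lemma padic_color_eq (p N x y : nat) :
  padic_color p N x = padic_color p N y ->
  [/\ unit_residue p x = unit_residue p y,
      (logn p x == 0%N) = (logn p y == 0%N)
    & forall r, (r <= N)%N ->
        logn r (logn p x) = logn r (logn p y) %[mod N.+1]].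
Proof.
case=> -> -> /ffunP exy; split=> // r rN.
have := congr1 val (exy (inord r)).
by rewrite !ffunE /= !inordK ?ltn_pmod.
Qed.

Theorem theorem2p1 (h : nat) (n s : 'I_h -> nat)
    (a : forall l : 'I_h, 'I_(s l) -> int) (p : nat) :
  (0 < h)%N ->
  (forall l : 'I_h, (0 < n l)%N) ->
  (forall l m : 'I_h, (l < m)%N -> (n l < n m)%N) ->
  (forall l : 'I_h, (0 < s l)%N) ->
  prime p ->
  (forall (l : 'I_h) (G : {set 'I_(s l)}), G != set0 ->
     (\sum_(i in G) a l i != 0 %[mod p])%Z) ->
  (forall rho : int, (rho != 0 %[mod p])%Z ->
     (\sum_(l < h) (\sum_(i < s l) a l i) * rho ^+ n l != 0 %[mod p])%Z) ->
  not_partition_regular_except_constant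
    (fun x : {l : 'I_h & 'I_(s l)} -> nat =>
       \sum_(l < h) \sum_(i < s l)
          a l i * (x (existT (fun l : 'I_h => 'I_(s l)) l i))%:Z ^+ n l).
Proof.
move=> h0 n0 nlt s0 p_pr partial_sums full_sums.
have eqF0 (z : int) : (z == 0 %[mod p])%Z = (z%:~R == 0 :> 'F_p).
  by rewrite -(dvdz_pcharf (pchar_Fp p_pr)) mod0z; apply/eqP/dvdz_mod0P.
have n_inj : injective n.
  move=> l m nlm; apply: val_inj; case: (ltngtP l m) => // /nlt.
    by rewrite nlm ltnn.
  by rewrite nlm ltnn.
pose J := {l : 'I_h & 'I_(s l)}.
pose j0 : J := Tagged (fun l => 'I_(s l)) (Ordinal (s0 (Ordinal h0))).
pose N := (\max_l n l)%N.
have nN l : (0 < n l <= N)%N by rewrite n0 /N leq_bigmax.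
apply: (not_partition_regular_of_finType _ _ _ (padic_color p N)).
move=> x xpos mono; rewrite sig_big_dep /= => sol.
pose w (j : J) := (n (tag j) * logn p (x j))%N.
case: (arg_minnP w (isT : xpredT j0)) => j1 _ minw.
have {}sol : \sum_(j : J) a (tag j) (tagged j) * (x j)%:Z ^+ n (tag j) = 0.
  by rewrite -[RHS]sol; apply: eq_bigr => -[].
have lead := @leading_part_eq0 p J _ x _ (w j1) p_pr xpos (fun j => minw j isT)
  sol.
pose rho := unit_residue p (x j1).
have rhoE j : unit_residue p (x j) = rho.
  by case: (padic_color_eq _ _ _ _ (mono j j1)).
have rho0 : rho != 0 by apply: unit_residue_neq0.
have zeroE j : (logn p (x j) == 0%N) = (logn p (x j1) == 0%N).
  by case: (padic_color_eq _ _ _ _ (mono j j1)).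
(* Either all unknowns are prime to p, or all are divisible by p. *)
have [e0|epos] := eqVneq (logn p (x j1)) 0%N.
  have wM j : w j = w j1.
    by rewrite /w e0 (eqP (_ : logn p (x j) == 0%N)) ?muln0 // zeroE e0.
  pose u : int := ((x j1)`_p^')%N.
  have u_neq0 : (u != 0 %[mod p])%Z by rewrite eqF0 -pmulrn.
  have /negP := full_sums u u_neq0; apply.
  rewrite eqF0 -[X in _ == X]lead rmorph_sum /=.
  under eq_bigr do rewrite rmorphM rmorph_sum rmorphXn /= mulr_suml.
  rewrite sig_big_dep /=; apply/eqP/eq_big => [j|j _].
    by rewrite -/(w j) wM eqxx.
  by rewrite rhoE.
(* All leading terms lie in the block of j1. *)
have same_tag j : w j == w j1 -> tag j = tag j1.
  move/eqP=> wj; apply: n_inj.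
  apply: (eq_of_mul_eq_logn_mod N _ _ (logn p (x j)) (logn p (x j1))) => //.
  - by rewrite lt0n zeroE.
  - by rewrite lt0n.
  by case: (padic_color_eq _ _ _ _ (mono j j1)).
pose l1 := tag j1.
pose pack l (i : 'I_(s l)) : J := Tagged (fun l => 'I_(s l)) i.
pose G := [set i : 'I_(s l1) | w (pack _ i) == w j1].
have G_neq0 : G != set0.
  by apply/set0Pn; exists (tagged j1); rewrite inE /pack taggedK.
have /negP := partial_sums l1 G G_neq0; apply.
rewrite eqF0 rmorph_sum -(inj_eq (mulIf (expf_neq0 (n l1) rho0))) mul0r.
rewrite mulr_suml -[X in _ == X]lead.
have -> : \sum_(j : J | (n (tag j) * logn p (x j) == w j1)%N)
      (a (tag j) (tagged j))%:~R * unit_residue p (x j) ^+ n (tag j) =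
    \sum_l \sum_(i : 'I_(s l) | w (pack _ i) == w j1)
      (a l i)%:~R * rho ^+ n l.
  rewrite sig_big_dep; apply: eq_big => [[]|[l i] _] //.
  by rewrite rhoE.
rewrite (bigD1 l1) //= [X in _ + X]big1 => [|l l_neq]; last first.
  rewrite big_pred0 // => i; apply: contraNF l_neq => /same_tag /= ->.
  exact: eqxx.
by rewrite addr0; apply/eqP/eq_bigl => i; rewrite inE.
Qed.
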